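(* Let $q$ be a prime power and let $m \ge 0$ be an integer. For $n\ge 1$, let $\mathcal{Q}_{q,n}$ be $n$ minus the rank of a uniformly random $n \times (n+m)$ matrix over $\mathbb{F}_q$, and let $\mathcal{Q}_q$ be the distributional limit of $\mathcal{Q}_{q,n}$ as $n\to\infty$ (with $m$ fixed). Then for every $n \ge 1$, $$d_{\rm TV}(\mathcal{Q}_{q,n},\mathcal{Q}_{q}) \le \frac{q}{q-1}\cdot\frac{1}{q^{n+m+1}}.$$
   Context: $\mathbb{F}_q$ is the finite field with $q$ elements. A uniformly random matrix has independent entries, each uniform on $\mathbb{F}_q$. For random elements $X,Y$ of a discrete space, $d_{\rm TV}(X,Y)=\sup_{B}|\mathbb{P}(X\in B)-\mathbb{P}(Y\in B)| = \sum_k \max(0,\mathbb{P}(X=k)-\mathbb{P}(Y=k))$. The dependence of $\mathcal{Q}_{q,n}$ and $\mathcal{Q}_q$ on $m$ is suppressed in the notation. *)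

(* Defs.v *)
From HB Require Import structures.
From mathcomp Require Import all_boot all_order all_algebra.
From mathcomp Require Import all_classical all_reals all_analysis.

Set Implicit Arguments.
Unset Strict Implicit.
Unset Printing Implicit Defensive.

Import Order.TTheory GRing.Theory Num.Theory.
Import numFieldNormedType.Exports.

Local Open Scope classical_set_scope.
Local Open Scope ring_scope.

(* Copy of 'M[F]_(r, c) carrying the discrete sigma-algebra. *)
Definition mx_space (F : finFieldType) (r c : nat) : Type := 'M[F]_(r, c).

HB.instance Definition _ (F : finFieldType) (r c : nat) :=
  Finite.copy (mx_space F r c) 'M[F]_(r, c).

HB.instance Definition _ (F : finFieldType) (r c : nat) :=
  isPointed.Build (mx_space F r c) (0 : 'M[F]_(r, c)).

HB.instance Definition _ (F : finFieldType) (r c : nat) :=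
  @isMeasurable.Build default_measure_display (mx_space F r c)
    discrete_measurable discrete_measurable0
    discrete_measurableC discrete_measurableU.

(* Product over the entries of the uniform mass 1/#|F| of each entry, i.e.
   independent entries, each uniform on F; it does not depend on the matrix. *)
Definition uniform_mx_pmf (R : realType) (F : finFieldType) (r c : nat)
    (M : mx_space F r c) : R :=
  \prod_(i < r) \prod_(j < c) (#|F|%:R)^-1.

Definition uniform_mx (R : realType) (F : finFieldType) (r c : nat) :
    set (mx_space F r c) -> \bar R :=
  fun U => (\sum_(M \in U) (uniform_mx_pmf R M)%:E)%E.

Section uniform_mx_probability.
Context (R : realType) (F : finFieldType) (r c : nat).

Local Notation mu := (@uniform_mx R F r c).

Lemma uniform_mx_pmf_ge0 (M : mx_space F r c) : 0 <= uniform_mx_pmf R M.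
Proof.
by apply: prodr_ge0 => i _; apply: prodr_ge0 => j _; rewrite invr_ge0.
Qed.

Let mu0 : mu set0 = 0%E.
Proof. by rewrite /uniform_mx fsbig_set0. Qed.

Let mu_ge0 U : (0 <= mu U)%E.
Proof.
rewrite /uniform_mx fsbig_finite//= sumEFin lee_fin.
by apply: sumr_ge0 => M _; exact: uniform_mx_pmf_ge0.
Qed.

Let mu_sigma_additive : semi_sigma_additive mu.
Proof.
move=> G mG tG mUG; apply: cvg_toP.
  apply: ereal_nondecreasing_is_cvgn => a b ab.
  by apply: lee_sum_nneg_natr => // k _ _; exact: mu_ge0.
transitivity (\sum_(0 <= i <oo)
    (\esum_(M in G i) (uniform_mx_pmf R M)%:E))%E.
  apply: eq_eseriesr => k _; rewrite esum_fset//= => M _.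
  by rewrite lee_fin uniform_mx_pmf_ge0.
rewrite -nneseries_sum_bigcup//=; last first.
  by move=> M; rewrite lee_fin uniform_mx_pmf_ge0.
by rewrite esum_fset//= => M _; rewrite lee_fin uniform_mx_pmf_ge0.
Qed.

HB.instance Definition _ := isMeasure.Build _ _ _ mu
  mu0 mu_ge0 mu_sigma_additive.

Let mu_setT : mu [set: _] = 1%E.
Proof.
have -> : [set: mx_space F r c] = [set` predT] by apply/seteqP; split.
rewrite /uniform_mx -(bigfs _ (index_enum_uniq (mx_space F r c))); last first.
  by move=> M _; rewrite mem_index_enum.
rewrite sumEFin; congr EFin.
rewrite /uniform_mx_pmf sumr_const prodr_const prodr_const !card_ord.
have -> : #|{: mx_space F r c}| = (#|F| ^ (r * c))%N by exact: card_mx.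
rewrite -exprM mulnC -[LHS]mulr_natr natrX -exprMn mulVf ?expr1n//.
by rewrite pnatr_eq0 -lt0n; apply/card_gt0P; exists 0.
Qed.

HB.instance Definition _ :=
  @Measure_isProbability.Build _ _ R mu mu_setT.

End uniform_mx_probability.

Definition corank (F : finFieldType) (r c : nat) (M : mx_space F r c) : nat :=
  (r - \rank (M : 'M[F]_(r, c)))%N.

HB.instance Definition _ (F : finFieldType) (r c : nat) :=
  @isMeasurableFun.Build _ _ (mx_space F r c) nat (@corank F r c)
    (fun _ _ _ => I).

(* The law of Q_{q,n}, where q = #|F|. *)
Definition corank_law (R : realType) (F : finFieldType) (m n : nat) :
    probability nat R :=
  distribution (@uniform_mx R F n (n + m)) (@corank F n (n + m)).

Definition dTV d (T : measurableType d) (R : realType)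
    (P Q : probability T R) : \bar R :=
  ereal_sup [set `|P B - Q B|%E | B in (measurable : set (set T))].

(* Weak convergence of laws on the discrete space nat. *)
Definition cvg_in_distribution (R : realType)
    (P : nat -> probability nat R) (Q : probability nat R) : Prop :=
  forall f : nat -> R, continuous f -> bounded_fun f ->
    (\int[P n]_k (f k)%:E)%E @[n --> \oo] --> (\int[Q]_k (f k)%:E)%E.

(* Main.v *)
From HB Require Import structures.
Require Import Defs.
From mathcomp Require Import all_boot all_order all_algebra mxabelem.
From mathcomp Require Import all_classical all_reals all_analysis.
From mathcomp Require Import ring lra.

Import Order.TTheory GRing.Theory Num.Theory.
Import numFieldNormedType.Exports.

(** Write p_n(k) for the probability that a uniform n x (n + m) matrix has corank
    k. The number of matrices of a given size and rank has a closed product form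
    (rank_countE), obtained by adding rows one at a time. In the ratio
    p_(n+1)(k) / p_n(k) nearly all factors cancel, and with a = q^-(n+1) it is
    (1 - a) (1 - a q^-m) / (1 - a q^k) (corank_law_ratio).

    For k >= 1 this ratio is at least 1, so p_n(k) increases with n
    (corank_law_atom_le); for k = 0 it equals 1 - q^-(n+m+1), so p_n(0) decreases
    by at most q^-(n+m+1) (corank_law_atom0S). Mass thus only ever moves from 0
    to the positive integers.

    This monotonicity yields both claims. The atoms converge, monotone
    convergence away from 0 shows that no mass is lost, and dominated convergence
    gives the weak limit (exists_limit_law). Any weak limit Q satisfies
    p_n(k) <= Q(k) for all k >= 1, so the total variation distance between p_n
    and Q is attained on the singleton of 0 and equals p_n(0) - Q(0)
    (dTV_le_atom0 bounds it by this difference). Summing the losses at 0 over all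
    later steps gives the geometric series q^-(n+m+1) + q^-(n+m+2) + ..., whose
    sum is the stated bound. *)

(** * Counting matrices of given rank over a finite field *)

Local Open Scope ring_scope.

(** A row outside the row space of A is nonzero and meets that space only
    in 0, so its line is in direct sum with it. *)
Lemma mxrank_col_mx_row (F : fieldType) n c (v : 'rV[F]_c) (A : 'M[F]_(n, c)) :
  \rank (col_mx v A) = (\rank A + ~~ (v <= A)%MS)%N.
Proof.
rewrite -addsmxE; have [vA|vA] := boolP (v <= A)%MS.
  by rewrite (addsmx_idPr vA) addn0.
have v0 : v != 0 by apply: contraNneq vA => ->; exact: sub0mx.
rewrite mxrank_disjoint_sum ?rank_rV ?v0 1?addnC //.
apply/eqP; rewrite -mxrank_eq0; move: vA; apply: contraNT => cap0.
have : (v :&: A == v)%MS.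
  rewrite -(geq_leqif (mxrank_leqif_eq (capmxSl v A))) rank_rV v0.
  by rewrite lt0n.
by case/andP=> _ /submx_trans; apply; exact: capmxSr.
Qed.

Definition rank_count (F : finFieldType) (n c r : nat) : nat :=
  #|[pred A : 'M[F]_(n, c) | \rank A == r]|.

Lemma card_submx_row (F : finFieldType) n c (A : 'M[F]_(n, c)) :
  #|[pred v : 'rV[F]_c | (v <= A)%MS]| = (#|F| ^ \rank A)%N.
Proof.
by rewrite -card_rowg; apply: eq_card => v; rewrite !inE.
Qed.

(** Cutting off the first row identifies matrices with n.+1 rows with pairs of
    a row and a matrix with n rows. *)
Lemma card_matrixS (F : finFieldType) n c (P : pred 'M[F]_(n.+1, c)) :
  #|P| =
  (\sum_(A : 'M[F]_(n, c))
     #|[pred v : 'rV[F]_c | P (col_mx v A : 'M[F]_(1 + n, c))]|)%N.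
Proof.
pose h (p : 'M[F]_(n, c) * 'rV[F]_c) : 'M[F]_(1 + n, c) := col_mx p.2 p.1.
have hK : cancel h (fun B => (dsubmx B, usubmx B)).
  by case=> A v; rewrite /h col_mxKd col_mxKu.
have Kh : cancel (fun B => (dsubmx B, usubmx B)) h by move=> B; exact: vsubmxK.
rewrite -sum1_card (reindex h) /=; last first.
  by exists (fun B => (dsubmx B, usubmx B)) => ? _.
under [RHS]eq_bigr do rewrite -sum1_card.
by rewrite pair_big_dep.
Qed.

(** A matrix of rank r.+1 arises by adding to a matrix of rank r.+1 a row of its
    row space, or to a matrix of rank r a row outside its row space. *)
Lemma rank_countS (F : finFieldType) n c r :
  rank_count F n.+1 c r.+1 =
  (rank_count F n c r.+1 * #|F| ^ r.+1 +
   rank_count F n c r * (#|F| ^ c - #|F| ^ r))%N.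
Proof.
rewrite /rank_count card_matrixS.
transitivity (\sum_(A : 'M[F]_(n, c)) ((\rank A == r.+1) * #|F| ^ r.+1 +
  (\rank A == r) * (#|F| ^ c - #|F| ^ r)))%N; last first.
  rewrite big_split /= -!big_distrl /=.
  congr (_ * _ + _ * _)%N; rewrite -sum1_card [RHS]big_mkcond /=;
    by apply: eq_bigr => A _; rewrite inE; case: ifP.
apply: eq_bigr => A _.
rewrite (@eq_card _ _ [pred v | if (v <= A)%MS then \rank A == r.+1
                                else \rank A == r]); last first.
  move=> v; rewrite !inE mxrank_col_mx_row.
  by case: ifP => _; rewrite ?addn0 // addn1.
have [e|ne] := eqVneq (\rank A) r.+1.
  rewrite e mul1n (gtn_eqF (ltnSn r)) mul0n addn0 -e -card_submx_row.
  by apply: eq_card => v; rewrite !inE; case: ifP.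
rewrite mul0n add0n; have [e|ne'] := eqVneq (\rank A) r.
  rewrite mul1n -e -card_submx_row -[X in (_ ^ X)%N]mul1n -card_mx.
  rewrite -[in X in (X - _)%N](cardC [pred v : 'rV[F]_c | (v <= A)%MS]) addKn.
  by apply: eq_card => v; rewrite !inE; case: ifP.
by rewrite mul0n; apply: eq_card0 => v; rewrite !inE; case: ifP.
Qed.

Lemma rank_count0 (F : finFieldType) n c : rank_count F n c 0 = 1%N.
Proof.
rewrite -(card1 (0 : 'M[F]_(n, c))); apply: eq_card => A.
by rewrite !inE mxrank_eq0.
Qed.

Lemma rank_count_gt (F : finFieldType) n c r : (n < r)%N -> rank_count F n c r = 0%N.
Proof.
move=> nr; apply: eq_card0 => A; rewrite !inE.
by apply/negbTE; rewrite neq_ltn (leq_ltn_trans (rank_leq_row A) nr).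
Qed.

Lemma rank_count_gtc (F : finFieldType) n c r : (c < r)%N -> rank_count F n c r = 0%N.
Proof.
move=> nr; apply: eq_card0 => A; rewrite !inE.
by apply/negbTE; rewrite neq_ltn (leq_ltn_trans (rank_leq_col A) nr).
Qed.

(** The number of r-tuples of linearly independent vectors in a space of
    dimension c over the field with q elements, as an element of a ring. For
    c < r the factor i = c vanishes. *)
Definition free_count {R : pzRingType} (q : R) (c r : nat) : R :=
  \prod_(i < r) (q ^+ c - q ^+ i).

Lemma free_countS (R : comPzRingType) (q : R) c r :
  free_count q c.+1 r.+1 = (q ^+ c.+1 - 1) * q ^+ r * free_count q c r.
Proof.
rewrite /free_count big_ord_recl expr0 -mulrA; congr (_ * _).
under eq_bigr => i _ do rewrite lift0 !exprS -mulrBr.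
by rewrite big_split /= prodr_const card_ord.
Qed.

Lemma free_countSr (R : pzRingType) (q : R) c r :
  free_count q c r.+1 = free_count q c r * (q ^+ c - q ^+ r).
Proof. by rewrite /free_count big_ord_recr. Qed.

(** A matrix of rank r is the product of an n x r and an r x c matrix of rank r,
    and GL_r acts simply transitively on such factorisations. The proof is by
    induction on the number of rows instead; keeping the order of GL_r on the left
    avoids divisions. *)
Lemma rank_countE (F : finFieldType) (R : comNzRingType) n c r :
  (rank_count F n c r)%:R * free_count #|F|%:R r r =
  free_count #|F|%:R c r * free_count #|F|%:R n r :> R.
Proof.
elim: n r => [|n IH] [|r].
- by rewrite rank_count0 /free_count !big_ord0.
- by rewrite rank_count_gt // mul0r [X in _ * X]big_ord_recl subrr mul0r mulr0.
- by rewrite rank_count0 /free_count !big_ord0.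
set q : R := #|F|%:R; rewrite rank_countS natrD !natrM.
(* The subtraction is truncated only when c < r, where the count is 0. *)
have -> : (rank_count F n c r)%:R * (#|F| ^ c - #|F| ^ r)%:R =
   (rank_count F n c r)%:R * (q ^+ c - q ^+ r).
  have [rc|/rank_count_gtc ->] := leqP r c; last by rewrite !mul0r.
  rewrite natrB ?natrX // leq_exp2l //; exact: card_finNzRing_gt1.
have := IH r; have := IH r.+1; rewrite -/q natrX -/q.
rewrite !free_countS !free_countSr.
set X := _%:R; set Y := _%:R => IHX IHY.
rewrite mulrDl.
have -> : X * q ^+ r.+1 * ((q ^+ r.+1 - 1) * q ^+ r * free_count q r r) =
  q ^+ r.+1 * (X * ((q ^+ r.+1 - 1) * q ^+ r * free_count q r r)) by ring.
have -> : Y * (q ^+ c - q ^+ r) * ((q ^+ r.+1 - 1) * q ^+ r * free_count q r r) =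
  (q ^+ c - q ^+ r) * (q ^+ r.+1 - 1) * q ^+ r * (Y * free_count q r r) by ring.
rewrite IHX IHY !exprS; ring.
Qed.

(** Passing from (n, c, r) to (n.+1, c.+1, r.+1), which leaves both n - r and
    c - n fixed, adds one factor to each of the three products in the closed form
    and leaves a ratio with only a few factors. *)
Lemma rank_count_shift (F : finFieldType) (R : numDomainType) n c r :
  let q := #|F|%:R : R in
  (rank_count F n.+1 c.+1 r.+1)%:R * (q ^+ r.+1 - 1) =
  q ^+ r * (q ^+ c.+1 - 1) * (q ^+ n.+1 - 1) * (rank_count F n c r)%:R.
Proof.
move=> q; have q1 : 1 < q by rewrite ltr1n card_finNzRing_gt1.
have q0 : q != 0 by rewrite gt_eqF // (lt_trans ltr01).
have D0 : free_count q r r != 0.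
  by apply/prodf_neq0 => i _; rewrite subr_eq0 gt_eqF // ltr_eXn2l.
have := rank_countE F R n.+1 c.+1 r.+1; rewrite -/q !free_countS => E.
apply: (mulIf D0); apply: (mulIf (expf_neq0 r q0)).
transitivity ((rank_count F n.+1 c.+1 r.+1)%:R *
  ((q ^+ r.+1 - 1) * q ^+ r * free_count q r r)); first by ring.
rewrite E.
transitivity ((q ^+ c.+1 - 1) * q ^+ r * ((q ^+ n.+1 - 1) * q ^+ r) *
  (free_count q c r * free_count q n r)); first by ring.
by rewrite -rank_countE -/q; ring.
Qed.

(** * Laws on the natural numbers whose atoms away from 0 increase *)

Local Open Scope classical_set_scope.
Local Open Scope ereal_scope.

Lemma measure_nat_series (R : realType) (P : {measure set nat -> \bar R})
    (B : set nat) :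
  P B = \sum_(k <oo | k \in B) P [set k].
Proof.
rewrite -measure_bigcup //.
  by congr (P _); apply/seteqP; split=> [k Bk|k [j Bj ->]//]; exists k.
by move=> i j _ _ [k [-> ->]].
Qed.

Lemma measure_nat_le (R : realType) (P P' : {measure set nat -> \bar R})
    (B : set nat) :
  (forall k, B k -> P [set k] <= P' [set k]) -> P B <= P' B.
Proof.
move=> PP'; rewrite !measure_nat_series; apply: lee_nneseries => // k.
by move=> /set_mem/PP'.
Qed.

Lemma probability_split0 (R : realType) (P : probability nat R) (B : set nat) :
  P B = P (B `&` [set 0%N]) + P (B `\ 0%N).
Proof.
rewrite -measureU //.
  by rewrite setDE -setIUr setUv setIT.
by apply/seteqP; split=> // k [[_ /= ->] [_]].
Qed.

Lemma probability_atom0 (R : realType) (P : probability nat R) :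
  P [set 0%N] = 1 - P [set~ 0%N].
Proof. by rewrite -probability_setC // setCK. Qed.

(** The difference P B - P' B is largest at B = [set 0]: it is nonpositive on
    sets avoiding 0, so adding points to [set 0] can only decrease it. Complements
    turn the bound on P B - P' B into one on its absolute value. *)
Lemma dTV_le_atom0 (R : realType) (P P' : probability nat R) :
  (forall k, (0 < k)%N -> P [set k] <= P' [set k]) ->
  dTV P P' <= P [set 0%N] - P' [set 0%N].
Proof.
move=> PP'.
have le0 B : ~ B 0%N -> P B <= P' B.
  by move=> B0; apply: measure_nat_le => -[|k] // _; exact: PP'.
have fP (Q : probability nat R) B : Q B \is a fin_num by exact: fin_num_measure.
have P0 : P' [set 0%N] <= P [set 0%N].
  by rewrite !probability_atom0; apply: leeB => //; apply: le0 => /=; exact.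
have half B : P B - P' B <= P [set 0%N] - P' [set 0%N].
  have [B0|/le0 leB] := pselect (B 0%N); last first.
    by rewrite (@le_trans _ _ 0) ?sube_le0 // sube_ge0 ?fP.
  rewrite (probability_split0 _ P B) (probability_split0 _ P' B).
  have -> : B `&` [set 0%N] = [set 0%N].
    by apply/seteqP; split=> [k []//|k /= ->].
  have /le0 : ~ (B `\ 0%N) 0%N by case=> _; exact.
  move: (fP P [set 0%N]) (fP P' [set 0%N]) (fP P (B `\ 0%N)) (fP P' (B `\ 0%N)).
  case: (P _) => // a _; case: (P' _) => // b _;
  case: (P _) => // c _; case: (P' _) => // e _.
  rewrite -?EFinD -?EFinB !lee_fin => ce; lra.
apply: ge_ereal_sup => _ [B _ <-].
have := half B; have := half (~` B); rewrite !probability_setC //.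
move: (fP P B) (fP P' B) (fP P [set 0%N]) (fP P' [set 0%N]).
case: (P B) => // a _; case: (P' B) => // b _;
  case: (P _) => // c _; case: (P' _) => // e _.
rewrite -!EFinB !lee_fin => h1 h2; rewrite ler_norml; lra.
Qed.

Lemma integrable_pmf (R : realType) (P : probability nat R) :
  counting.-integrable [set: nat] (fun k => P [set k]).
Proof.
apply/integrableP; split=> //.
under eq_integral do rewrite gee0_abs //.
rewrite ge0_integral_count // (_ : \sum_(k <oo) _ = P setT).
  by rewrite ltey_eq fin_num_measure.
by rewrite measure_nat_series; apply: eq_eseriesl => k; rewrite in_setT.
Qed.

Lemma measure_nat_counting (R : realType) (P : {measure set nat -> \bar R})
    (B : set nat) :
  P B = \int[counting]_(k in B) P [set k].
Proof.
rewrite integral_mkcond ge0_integral_count; last first.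
  by move=> k; rewrite patchE; case: ifP.
rewrite measure_nat_series eseries_mkcond; apply: eq_eseriesr => k _.
by rewrite patchE.
Qed.

Lemma integral_probability_nat (R : realType) (P : probability nat R) (f : nat -> R) :
  bounded_fun f ->
  \int[P]_k (f k)%:E = \int[counting]_k ((f k)%:E * P [set k]).
Proof.
move=> bf.
have intf : P.-integrable setT (EFin \o f).
  apply: measurable_bounded_integrable => //.
  by rewrite ltey_eq fin_num_measure.
have cover : \bigcup_k [set k] = [set: nat].
  by apply/seteqP; split=> // k _; exists k.
have triv : trivIset setT (fun k : nat => [set k]).
  by move=> i j _ _ [k [-> ->]].
have atom k : \int[P]_(x in [set k]) (f x)%:E = (f k)%:E * P [set k].
  rewrite -integral_cst //; apply: eq_integral => x.
  by rewrite inE => ->.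
rewrite -cover in intf.
rewrite -[in LHS]cover (integral_bigcup triv) //.
rewrite integral_count.
  by apply: eq_eseriesr => k _; exact: atom.
rewrite (_ : (fun k => _) = (fun k => \int[P]_(x in [set k]) (f x)%:E)); last first.
  by apply/funext => k; rewrite atom.
exact: (integrable_summable triv _ intf).
Qed.

(** Dominated convergence needs one fixed measure: integrals against the laws
    P n become integrals against the counting measure, with the atoms as
    densities. *)
Lemma dominated_pmf_cvg (R : realType) (P : nat -> probability nat R)
    (Q : probability nat R) (g : nat -> \bar R) :
  counting.-integrable [set: nat] g ->
  (forall k, g k \is a fin_num) ->
  (forall n k, P n [set k] <= g k) ->
  (forall k, P n [set k] @[n --> \oo] --> Q [set k]) ->
  cvg_in_distribution P Q.
Proof.
move=> ig fg Pg PQ f _ bf.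
under eq_fun do rewrite integral_probability_nat //.
rewrite integral_probability_nat //.
have [M [_ /(_ (M + 1)%R)]] := bf; rewrite ltrDl ltr01 => /(_ isT) fM.
apply: (@dominated_cvg _ _ _ counting setT measurableT _ _
  (fun k => (M + 1)%:E * g k)).
- by [].
- by move=> k _; apply: cvgeZl => //; exact: PQ.
- by move=> k _; rewrite fin_numM.
- exact: integrableZl.
- move=> n k _; rewrite abseM [`|P n _|]gee0_abs //; apply: lee_pmul => //.
  by rewrite abse_EFin lee_fin; exact: fM.
Qed.

Section measure_of_pmf.
Context {R : realType} {w : nat -> \bar R} (w0 : forall k, 0 <= w k).

(** The nonnegativity proof is an argument only so that the measure structure
    below can be attached to the function. *)
Definition measure_of_pmf of (forall k, 0 <= w k) :=
  fun B : set nat => \esum_(k in B) w k.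

Local Notation mu := (measure_of_pmf w0).

Let mu0 : mu set0 = 0. Proof. exact: esum_set0. Qed.

Let mu_ge0 B : 0 <= mu B. Proof. exact: esum_ge0. Qed.

Let mu_sigma_additive : semi_sigma_additive mu.
Proof.
move=> B _ tB _; apply: cvg_toP.
  apply: ereal_nondecreasing_is_cvgn => a b ab.
  by apply: lee_sum_nneg_natr => // k _ _; exact: mu_ge0.
by rewrite /measure_of_pmf nneseries_sum_bigcup.
Qed.

HB.instance Definition _ := isMeasure.Build _ _ _ mu
  mu0 mu_ge0 mu_sigma_additive.

Lemma measure_of_pmf1 k : mu [set k] = w k.
Proof. exact: esum_set1. Qed.

End measure_of_pmf.

Section monotone_atoms.
Context (R : realType) (P : nat -> probability nat R).
Hypothesis monoP :
  forall n k, (0 < k)%N -> P n [set k] <= P n.+1 [set k].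

Lemma nondecreasing_avoid0 B : ~ B 0%N -> nondecreasing_seq (fun n => P n B).
Proof.
move=> B0; apply/nondecreasing_seqP => n; apply: measure_nat_le => -[|k] // _.
exact: monoP.
Qed.

Lemma is_cvg_avoid0 B : ~ B 0%N -> cvg (P n B @[n --> \oo]).
Proof. by move=> B0; apply/ereal_nondecreasing_is_cvgn/nondecreasing_avoid0. Qed.

Lemma is_cvg_atom k : cvg (P n [set k] @[n --> \oo]).
Proof.
case: k => [|k]; last exact: is_cvg_avoid0.
under eq_fun do rewrite probability_atom0.
have /cvg_ex[b Pb] : cvg (P n [set~ 0%N] @[n --> \oo]).
  by apply: is_cvg_avoid0 => /(_ erefl).
apply/cvg_ex; exists (1 - b); apply: cvgeB => //; last exact: cvg_cst.
Qed.

Lemma le_limit_atom n k l :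
  (0 < k)%N -> P N [set k] @[N --> \oo] --> l -> P n [set k] <= l.
Proof.
move=> k0 /cvge_to_ge; apply; exists n => // N /= nN.
by apply: nondecreasing_avoid0 nN => /= k0'; rewrite -k0' in k0.
Qed.

(** The limit law is built from the limits of the atoms. By monotone convergence
    on the complement of 0 no mass escapes to infinity, so that the limits of the
    atoms add up to 1. *)
Lemma exists_limit_law : exists Q : probability nat R, cvg_in_distribution P Q.
Proof.
pose w k := limn (fun n => P n [set k]).
have w0 k : 0 <= w k by apply: lime_ge; [exact: is_cvg_atom|exact: nearW].
pose mu : {measure set nat -> \bar R} := measure_of_pmf w0.
have mu1 k : mu [set k] = w k by exact: measure_of_pmf1.
have Pw k : P n [set k] @[n --> \oo] --> mu [set k].
  by rewrite mu1; exact: is_cvg_atom.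
have PC0 : P n [set~ 0%N] @[n --> \oo] --> mu [set~ 0%N].
  under eq_fun do rewrite measure_nat_counting.
  rewrite measure_nat_counting.
  under eq_integral do rewrite mu1.
  apply: cvg_monotone_convergence => //.
  by move=> k k0; apply: nondecreasing_avoid0 => /= /esym.
have muT : mu [set: nat] = 1.
  have -> : mu setT = mu [set 0%N] + mu [set~ 0%N].
    by rewrite -measureU ?setUv // setICr.
  have : P n setT @[n --> \oo] --> mu [set 0%N] + mu [set~ 0%N].
    rewrite (_ : (fun n => _) = (fun n => P n [set 0%N] + P n [set~ 0%N])); last first.
      by apply/funext => n; rewrite -measureU ?setUv // setICr.
    apply: cvgeD => //.
    by rewrite ge0_adde_def // inE.
  under eq_fun do rewrite probability_setT.
  by move=> /cvg_lim <- //; rewrite lim_cst.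
pose Q : probability nat R :=
  HB.pack (measure_of_pmf w0)
    (Measure_isProbability.Build _ _ _ (measure_of_pmf w0) muT).
exists Q.
(* The atoms grow to their limits, except the one at 0, which is at most 1. *)
apply: (@dominated_pmf_cvg _ _ _ (fun k => Q [set k] + \d_0%N [set k])).
- by apply: integrableD => //; exact: integrable_pmf.
- by move=> k; rewrite fin_numD !fin_num_measure.
- move=> n [|k].
    rewrite diracE mem_set //; apply: le_trans (probability_le1 _ _) _ => //.
    by rewrite leeDr.
  apply: le_trans (leeDl _ _) => //.
  exact: le_limit_atom (Pw k.+1).
- exact: Pw.
Qed.

End monotone_atoms.

(** Every indicator function on the discrete space of natural numbers is a
    continuous bounded test function. *)
Lemma cvg_in_distribution_set (R : realType) (P : nat -> probability nat R) Q B :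
  cvg_in_distribution P Q -> P n B @[n --> \oo] --> Q B.
Proof.
move=> /(_ \1_B).
have int1 (P' : probability nat R) : \int[P']_k (\1_B k)%:E = P' B.
  by rewrite integral_indic // setIT.
rewrite int1 (_ : (fun n => _) = (fun n => P n B)); last exact/funext.
apply.
  move=> k U; rewrite nbhs_simpl /= => /nbhs_singleton Uk.
  by rewrite nbhs_principalE; apply/principal_filterP.
exists 1%R; split=> // M M1 k _ /=.
by rewrite indicE ger0_norm // (le_trans _ (ltW M1)) // lern1 leq_b1.
Qed.

(** The atoms of the limit law dominate those of P n away from 0, hence the
    distance is the mass that 0 still has to lose, which is controlled by the
    losses up to each finite N. *)
Lemma dTV_limit_le (R : realType) (P : nat -> probability nat R) Q n (e : \bar R) :
  (forall n k, (0 < k)%N -> P n [set k] <= P n.+1 [set k]) ->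
  cvg_in_distribution P Q ->
  (forall N, (n <= N)%N -> P n [set 0%N] - P N [set 0%N] <= e) ->
  dTV (P n) Q <= e.
Proof.
move=> monoP PQ Pe; have PQB B := @cvg_in_distribution_set _ _ _ B PQ.
apply: (le_trans (dTV_le_atom0 _ _ _ _)).
  by move=> k k0; exact: (le_limit_atom _ _ monoP n k _ k0 (PQB [set k])).
apply: (@cvge_to_le _ \oo _ _ (fun N => P n [set 0%N] - P N [set 0%N])).
  apply: cvgeB => //; last exact: cvg_cst.
  by rewrite fin_num_adde_defr // fin_num_measure.
by exists n.
Qed.

Local Close Scope ereal_scope.

(** * The corank of a uniform matrix *)

Lemma uniform_mxE (R : realType) (F : finFieldType) r c (P : pred (mx_space F r c)) :
  @uniform_mx R F r c [set` P] = (#|P|%:R / #|F|%:R ^+ (r * c))%:E.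
Proof.
rewrite /uniform_mx -(bigfs _ (index_enum_uniq (mx_space F r c))); last first.
  by move=> M _; rewrite mem_index_enum.
rewrite sumEFin /uniform_mx_pmf sumr_const !prodr_const !card_ord.
by rewrite -exprM mulnC exprVn; congr EFin; rewrite -[LHS]mulr_natl.
Qed.

Lemma corank_law_atom (R : realType) (F : finFieldType) m n k : (k <= n)%N ->
  corank_law R F m n [set k] =
  ((rank_count F n (n + m) (n - k))%:R / #|F|%:R ^+ (n * (n + m)))%:E.
Proof.
move=> kn.
have -> : corank_law R F m n [set k] = @uniform_mx R F n (n + m)
    [set` [pred M : mx_space F n (n + m) | \rank (M : 'M[F]_(_, _)) == (n - k)%N]].
  congr (@uniform_mx _ _ _ _ _); apply/seteqP; split=> M /=; rewrite /corank inE.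
    by move=> <-; rewrite subKn // rank_leq_row.
  by move=> /eqP ->; rewrite subKn.
by rewrite uniform_mxE.
Qed.

Lemma corank_law_atom_gt (R : realType) (F : finFieldType) m n k : (n < k)%N ->
  corank_law R F m n [set k] = 0%E.
Proof.
move=> nk; rewrite -[LHS]/(@uniform_mx R F n (n + m) (@corank F n (n + m) @^-1` [set k])).
rewrite (_ : _ @^-1` _ = set0) ?measure0 //.
apply/seteqP; split=> // M /= e; move: nk; rewrite -e /corank ltnNge.
by rewrite leq_subr.
Qed.

(** The ratio of the k-th atoms for consecutive n, with denominators cleared: with
    a = q ^- n.+1 it reads
    p n.+1 / p n = (1 - a) (1 - a q ^- m) / (1 - a q ^+ k).
    Corank k is rank n - k, so that growing n shifts the rank too. *)
Lemma corank_law_ratio (R : realType) (F : finFieldType) m n k : (k <= n)%N ->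
  let q := #|F|%:R : R in
  let p j := (rank_count F j (j + m) (j - k))%:R / q ^+ (j * (j + m)) in
  p n.+1 * (q ^+ n.+1 - q ^+ k) * q ^+ (n + m).+1 =
  p n * (q ^+ n.+1 - 1) * (q ^+ (n + m).+1 - 1).
Proof.
move=> kn q p; have q1 : 1 < q by rewrite ltr1n card_finNzRing_gt1.
have q0 : q != 0 by rewrite gt_eqF // (lt_trans ltr01).
rewrite /p subSn // addSn.
have := rank_count_shift F R n (n + m) (n - k); rewrite /= -/q.
set N := (rank_count F n.+1 _ _)%:R; set N0 := (rank_count F n _ _)%:R.
have -> : (n.+1 * (n + m).+1 = n * (n + m) + (n + m).+1 + (n - k) + k)%N.
  by rewrite -addnA subnK //; ring.
have -> : q ^+ n.+1 - q ^+ k = q ^+ k * (q ^+ (n - k).+1 - 1).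
  by rewrite mulrBr mulr1 -exprD addnS subnKC.
rewrite !exprD => E.
rewrite [LHS](_ : _ = (N * (q ^+ (n - k).+1 - 1)) / q ^+ (n * (n + m)) / q ^+ (n - k)).
  by rewrite E; field; rewrite !expf_neq0.
by field; rewrite !expf_neq0.
Qed.

(** For k > 0 the ratio of consecutive atoms is at least 1, since
    q ^+ k >= 2 >= 1 + q ^- m. If n < k the atom for n is still 0. *)
Lemma corank_law_atom_le (R : realType) (F : finFieldType) m n k : (0 < k)%N ->
  (corank_law R F m n [set k] <= corank_law R F m n.+1 [set k])%E.
Proof.
move=> k0; have [nk|kn] := ltnP n k; first by rewrite corank_law_atom_gt.
rewrite !corank_law_atom ?leqW // lee_fin.
have := corank_law_ratio R F m n k kn; rewrite /=.
set q : R := #|F|%:R.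
set p := (X in X * _ * _ = _ -> _); set p' := (X in _ = X * _ * _ -> _).
have q2 : 2 <= q by rewrite ler_nat card_finNzRing_gt1.
have q_ge1 i : 1 <= q ^+ i by rewrite exprn_ege1 //; lra.
have qk : 2 <= q ^+ k.
  by rewrite -(prednK k0) exprS; have := q_ge1 k.-1; nra.
have qkn : q ^+ k < q ^+ n.+1 by rewrite ltr_eXn2l //; lra.
have qnm : q ^+ n.+1 <= q ^+ (n + m).+1 by rewrite ler_weXn2l //;
  [lra|rewrite ltnS leq_addr].
have p0 : 0 <= p' by rewrite divr_ge0 // exprn_ge0 //; lra.
have := q_ge1 (n + m).+1.
move: (q ^+ k) (q ^+ n.+1) (q ^+ (n + m).+1) qk qkn qnm => b a d qk qkn qnm d1 E.
have ab : 0 < (a - b) * d by rewrite mulr_gt0 ?subr_gt0 //; lra.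
rewrite -(ler_pM2r ab) [X in _ <= X]mulrA E -mulrA ler_wpM2l //; nra.
Qed.

(** At k = 0 the factor 1 - q ^- n.+1 cancels from the ratio, which becomes
    1 - q ^- (n + m + 1): the atom at 0 loses the fraction q ^- (n + m + 1) of
    its mass, which is at most 1. *)
Lemma corank_law_atom0S (R : realType) (F : finFieldType) m n :
  (corank_law R F m n [set 0%N] <=
   corank_law R F m n.+1 [set 0%N] + (1 / #|F|%:R ^+ (n + m + 1))%:E)%E.
Proof.
have p1 := probability_le1 (corank_law R F m n) (I : measurable [set 0%N]).
move: p1; rewrite !corank_law_atom // -EFinD !lee_fin addn1.
have := corank_law_ratio R F m n 0 (leq0n _); rewrite /=.
set q : R := #|F|%:R.
set p := (X in X * _ * _ = _ -> _); set p' := (X in _ = X * _ * _ -> _).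
have q2 : 2 <= q by rewrite ler_nat card_finNzRing_gt1.
have qn0 : q ^+ n.+1 - 1 != 0.
  by rewrite subr_eq0 gt_eqF // exprn_egt1 //; lra.
have d0 : 0 < q ^+ (n + m).+1 by rewrite exprn_gt0 //; lra.
rewrite expr0 -mulrAC -[RHS]mulrAC => /(mulIf qn0) E p1.
rewrite -/p' in p1 *.
rewrite -(ler_pM2r d0) mulrDl E mul1r mulVf ?gt_eqF //; lra.
Qed.

(** The total loss is a partial sum of the geometric series whose tail from n on
    is q / (q - 1) * q ^- (n + m + 1). *)
Lemma corank_law_atom0_le (R : realType) (F : finFieldType) m n N : (n <= N)%N ->
  (corank_law R F m n [set 0%N] - corank_law R F m N [set 0%N] <=
   (#|F|%:R / (#|F|%:R - 1) * (1 / #|F|%:R ^+ (n + m + 1)))%:E)%E.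
Proof.
move=> nN; set q : R := #|F|%:R; have q2 : 2 <= q by rewrite ler_nat card_finNzRing_gt1.
have q0 : q != 0 by rewrite gt_eqF //; lra.
have q1 : q - 1 != 0 by rewrite gt_eqF //; lra.
(* t j is the tail from j on of the geometric series. *)
pose t j := q / (q - 1) * (1 / q ^+ (j + m + 1)).
have t0 j : 0 <= t j by rewrite !(mulr_ge0, invr_ge0, exprn_ge0) //; lra.
have tS j : t j = t j.+1 + 1 / q ^+ (j + m + 1).
  rewrite /t 2!addSn exprS; field; rewrite q0 q1 expf_neq0 //.
suff : (corank_law R F m n [set 0%N] <=
        corank_law R F m N [set 0%N] + (t n - t N)%:E)%E.
  move=> h; rewrite leeBlDl ?fin_num_measure //; apply: le_trans h _.
  by rewrite leeD2l // lee_fin -/(t n) lerBlDr lerDl.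
elim: N nN => [|N IH]; first by rewrite leqn0 => /eqP ->; rewrite subrr adde0.
rewrite leq_eqVlt => /predU1P[<-|/IH nN]; first by rewrite subrr adde0.
apply: (le_trans nN); apply: le_trans (leeD2r _ (corank_law_atom0S _ _ _ _)) _.
by rewrite -addeA leeD2l // -EFinD lee_fin (tS N); lra.
Qed.

Theorem theorem3p5 (R : realType) (q m : nat) (F : finFieldType)
    (hF : #|F| = q) :
  (exists Q : probability nat R,
     cvg_in_distribution (fun n : nat => corank_law R F m n) Q) /\
  (forall Q : probability nat R,
     cvg_in_distribution (fun n : nat => corank_law R F m n) Q ->
     forall n : nat, (1 <= n)%N ->
       (dTV (corank_law R F m n) Q <=
         (q%:R / (q%:R - 1) * (1 / q%:R ^+ (n + m + 1)))%:E)%E).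
Proof.
have mono n k : (0 < k)%N ->
    (corank_law R F m n [set k] <= corank_law R F m n.+1 [set k])%E.
  exact: corank_law_atom_le.
split; first exact: exists_limit_law mono.
move=> Q PQ n _; rewrite -hF.
by apply: (dTV_limit_le _ _ _ _ _ mono PQ) => N; exact: corank_law_atom0_le.
Qed.
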